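(* Let $\alpha\in(0,1)$. Consider $n$ i.i.d. real-valued observations with distribution $F$ and density $f$ such that $f$ is strictly positive and continuous at $F^{-1}(\alpha)$. Let $l_n$ of the observations be contaminated and let $\tilde q_\alpha$ be the sample quantile with parameter $\alpha$ of the contaminated sample. If $l_n=o(n^{1/2})$, then $$\sqrt n\,(\tilde q_\alpha-F^{-1}(\alpha))\stackrel{d}{\to}N\Big(0,\frac{\alpha(1-\alpha)}{f^2(F^{-1}(\alpha))}\Big)\quad\text{as } n\to\infty.$$
   Context: Sample quantile: for a sample $(x_1,\dots,x_n)\in\mathbb R^n$ with increasing rearrangement $\tilde x_1\le\dots\le\tilde x_n$, the sample quantile with parameter $\alpha$ is $q_\alpha(x_1,\dots,x_n)=\frac12(\tilde x_{\lceil n\alpha\rceil}+\tilde x_{\lfloor n\alpha+1\rfloor})$. Contamination of $l_n$ observations means that $l_n$ of the $n$ i.i.d. observations are replaced by arbitrary real random variables (arbitrary distributions, arbitrary dependence among themselves and with the remaining observations, arbitrary positions). *)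

(* Defs.v *)
From HB Require Import structures.
From mathcomp Require Import all_boot all_order all_algebra.
From mathcomp Require Import all_classical all_reals all_analysis.
From mathcomp Require Import measurable_realfun.

Set Implicit Arguments.
Unset Strict Implicit.
Unset Printing Implicit Defensive.

Import Order.TTheory GRing.Theory Num.Theory.
Import numFieldNormedType.Exports.

Local Open Scope classical_set_scope.
Local Open Scope ring_scope.

(* Generalized inverse F^{-1}(a) = inf {x | a <= F x}. *)
Definition quantile_fun (R : realType) (F : R -> R) (a : R) : R :=
  inf [set x | a <= F x].

Definition is_density (R : realType) (F f : R -> R) : Prop :=
  [/\ measurable_fun [set: R] f,
      forall x, 0 <= f x &
      forall x, (F x)%:E =
        (\int[lebesgue_measure]_(y in `]-oo, x]) (f y)%:E)%E].

Definition mutually_independent (d : measure_display) (T : measurableType d)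
    (R : realType) (P : probability T R) (I : finType)
    (X : I -> {RV P >-> R}) : Prop :=
  forall (J : {set I}) (A : I -> set R), (forall i, measurable (A i)) ->
    P (\bigcap_(i in [set` J]) (X i @^-1` A i)) =
    (\prod_(i in J) P (X i @^-1` A i))%E.

(* The set S w of replaced positions may depend on the outcome w; a
   deterministic choice of positions is the case where S is constant.
   Nothing is required of Y w i for i in S w. *)
Definition contaminated (T R : Type) (n l : nat) (X Y : 'I_n -> T -> R)
    : Prop :=
  exists S : T -> {set 'I_n}, forall w,
    #|S w| = l /\ forall i, i \notin S w -> Y i w = X i w.

(* The rank k is 1-based: order_stat x 1 is the smallest observation. *)
Definition order_stat (R : realType) (n : nat) (x : 'I_n -> R) (k : nat) : R :=
  nth 0 (sort <=%R [seq x i | i <- enum 'I_n]) k.-1.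

Definition sample_quantile (R : realType) (n : nat) (a : R) (x : 'I_n -> R)
    : R :=
  2^-1 * (order_stat x `|Num.ceil (n%:R * a)|%N
          + order_stat x `|Num.floor (n%:R * a + 1)|%N).

Section measurability.
Context (d : measure_display) (T : measurableType d) (R : realType) (n : nat).
Variable Y : 'I_n -> {mfun T >-> R}.

Lemma measurable_order_stat (k : nat) :
  measurable_fun [set: T] (fun w => order_stat (fun i => Y i w) k).
Proof.
rewrite /order_stat; move: k.-1 => {}k.
pose s w := sort <=%R [seq Y i w | i <- enum 'I_n].
have szs w : size (s w) = n by rewrite size_sort size_map size_enum_ord.
have [nk|kn] := leqP n k.
  rewrite (_ : (fun _ => _) = cst 0); first exact: measurable_cst.
  by apply/funext => w /=; rewrite nth_default// -/(s w) szs.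
apply: (measurability _ (RGenOInfty.measurableE R)) => // _ [_ [t ->] <-].
pose N w : R := \sum_(i < n) \1_(Y i @^-1` `]-oo, t]) w.
have mN : measurable_fun [set: T] N.
  apply: measurable_sum => i; apply: measurable_indic.
  rewrite -[X in measurable X]setTI.
  by apply: measurable_funP.
have NE w : N w = (count (<= t) (s w))%:R.
  rewrite count_sort count_map -sum1_count natr_sum big_enum_cond/=.
  rewrite [RHS]big_mkcond; apply: eq_bigr => i _ /=.
  rewrite indicE (_ : (w \in _) = (Y i w <= t)); first by case: (_ <= _).
  by apply/idP/idP; rewrite inE/= in_itv.
rewrite (_ : setT `&` _ = N @^-1` `]-oo, k%:R]); last first.
  apply/seteqP; split => w /=; rewrite !in_itv/= NE ler_nat andbT -/(s w).
    move=> [_ tk]; rewrite leqNgt; apply/negP => kc.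
    have : nth 0 (s w) k <= t.
      by apply: nth_count_le => //; exact: sort_le_sorted.
    by rewrite leNgt tk.
  move=> ck; split=> //; apply: nth_count_gt; first exact: sort_le_sorted.
  by rewrite ck szs.
by rewrite -[X in measurable X]setTI; exact: mN.
Qed.

Lemma measurable_sample_quantile (a : R) :
  measurable_fun [set: T] (fun w => sample_quantile a (fun i => Y i w)).
Proof.
apply: measurable_funM => //.
by apply: measurable_funD; exact: measurable_order_stat.
Qed.

Let sample_quantile_fun (a : R) : T -> R :=
  fun w => sample_quantile a (fun i => Y i w).

HB.instance Definition _ (a : R) :=
  @isMeasurableFun.Build _ _ _ _ (sample_quantile_fun a)
    (measurable_sample_quantile a).

Definition sample_quantile_rv (a : R) : {mfun T >-> R} :=
  sample_quantile_fun a.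

End measurability.

(* Each Z n may live on its own probability space (triangular array). *)
Definition cvg_in_distribution (R : realType) (d : nat -> measure_display)
    (T : forall n, measurableType (d n)) (P : forall n, probability (T n) R)
    (Z : forall n, {RV (P n) >-> R})
    (nu : probability (measurableTypeR R) R) : Prop :=
  forall x : R,
    {for x, continuous (fun y : R => nu `]-oo, y]%classic)} ->
    cdf (Z n) x @[n --> \oo] --> nu `]-oo, x]%classic.

(* Main.v *)
Require Import Defs.
From HB Require Import structures.
From mathcomp Require Import all_boot all_order all_algebra.
From mathcomp Require Import all_classical all_reals all_analysis.
From mathcomp Require Import measurable_realfun.
From mathcomp Require Import ring lra zify.
Import Order.TTheory GRing.Theory Num.Theory.
Import numFieldNormedType.Exports.
Local Open Scope classical_set_scope.
Local Open Scope ring_scope.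

(** Write q for the quantile F^-1(alpha) and put t = q + x / sqrt n. An order
    statistic is at most t exactly when enough observations are at most t. Since
    the two ranks in the sample quantile are n alpha up to 1, and since
    contamination changes the number of observations below t by at most l n, the
    event that sqrt n times the centred quantile is at most x lies between the
    two events

      N >= n alpha + l n + 1    and    N >= n alpha - l n,

    where N counts the uncontaminated observations below t
    (sample_quantile_changed). By independence N is binomial with parameters n
    and p n = F t (prob_card_below). The density being continuous at q, F has
    derivative f q there, so that n (p n) = n alpha + sqrt n (f q) x + o(sqrt n),
    and l n = o(sqrt n) is absorbed in the error. Both probabilities therefore
    converge to the same Gaussian value as soon as a central limit theorem holds
    for binomial laws with a varying parameter (binomial_clt).

    That theorem is proved by Lindeberg's replacement method with a special
    choice of test functions. If Psi is the distribution function of a centred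
    Gaussian law of variance s^2, then u(t, w) = Psi ((b + w) / sqrt t) is an
    explicit solution of the heat equation u_t = (s^2 / 2) u_ww, smooth for t > 0
    and close to the indicator of b + w >= 0 for small t. Averaging u(t, .) over a
    centred Bernoulli step of variance s^2 h gives u(t + h, .), up to the Taylor
    remainders, of order 3 in the step and of order 2 in h (heat_step).
    Iterating n times (lindeberg_binomial), the mean of u(t, .) under the
    rescaled binomial law is close to u(t + n h, 0), the value wanted when t is
    small and n h is close to 1. The closed form of u replaces the convolutions of
    Gaussian laws and the integrals depending on a parameter that general test
    functions would bring in. *)

(** * Taylor expansions with explicit remainders *)

Section taylor.
Context {R : realType}.
Implicit Types (f : R -> R) (a b M : R).

(** The endpoints come in either order because the increments of a centred
    binomial walk have both signs. *)
Lemma mean_value_bound f (df : R -> R) a b M :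
  (forall z, Num.min a b <= z <= Num.max a b ->
     is_derive z 1 f (df z) /\ `|df z| <= M) ->
  `|f b - f a| <= M * `|b - a|.
Proof.
wlog ab : a b / a <= b.
  move=> H dfM; have [/H|/ltW/H ba] := leP a b; first exact.
  by rewrite distrC [`|b - a|]distrC; apply: ba => z; rewrite minC maxC; exact: dfM.
rewrite (min_idPl ab) (max_idPr ab) => dfM.
have D z : z \in `[a, b] -> is_derive z 1 f (df z).
  by rewrite in_itv/= => /dfM[].
have [c cab ->] := MVT_segment ab (fun z zab => D z (subset_itv_oo_cc zab))
  (derivable_within_continuous (fun z zab => @ex_derive _ _ _ _ _ _ _ (D z zab))).
by rewrite normrM ler_wpM2r//; move: cab; rewrite in_itv/= => /dfM[].
Qed.

Lemma between_dist {a b z} :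
  Num.min a b <= z <= Num.max a b -> `|z - a| <= `|b - a|.
Proof.
have [ab|ba] := leP a b => /andP[az zb].
  by rewrite !ger0_norm ?subr_ge0// lerB.
by rewrite !ler0_norm ?subr_le0 ?(ltW ba)//; lra.
Qed.

Lemma between_sub {a b z} : Num.min a b <= z <= Num.max a b ->
  forall y, Num.min a z <= y <= Num.max a z ->
  Num.min a b <= y <= Num.max a b.
Proof.
by move=> abz y; move: abz; have [ab|ba] := leP a b; have [az|za] := leP a z; lra.
Qed.

(** The remainder, as a function of its endpoint, has a derivative bounded by
    the mean value inequality one order lower. A central limit theorem
    tolerates the crude constant 1 in place of 1/2 and 1/6. *)
Lemma taylor_order1 f (f1 f2 : R -> R) a b M :
  (forall z, Num.min a b <= z <= Num.max a b ->
     [/\ is_derive z 1 f (f1 z), is_derive z 1 f1 (f2 z) & `|f2 z| <= M]) ->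
  `|f b - f a - f1 a * (b - a)| <= M * `|b - a| ^+ 2.
Proof.
move=> H; pose g z := f z - f1 a * z.
have -> : f b - f a - f1 a * (b - a) = g b - g a by rewrite /g; ring.
rewrite expr2 mulrA; apply: (mean_value_bound _ (fun z => f1 z - f1 a)) => z zab.
have [d1 _ _] := H z zab; split.
  by apply: is_derive_eq; rewrite /GRing.scale/=; ring.
have M0 : 0 <= M by have [_ _] := H z zab; exact: le_trans.
apply: le_trans (_ : M * `|z - a| <= _).
  apply: (mean_value_bound _ f2) => y /(between_sub zab)/H[? ? ?].
  by split.
by rewrite ler_wpM2l// between_dist.
Qed.

Lemma taylor_order2 f (f1 f2 f3 : R -> R) M a b :
  (forall z : R, is_derive z 1 f (f1 z)) ->
  (forall z : R, is_derive z 1 f1 (f2 z)) ->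
  (forall z : R, is_derive z 1 f2 (f3 z)) ->
  (forall z, `|f3 z| <= M) ->
  `|f b - f a - f1 a * (b - a) - f2 a / 2 * (b - a) ^+ 2| <= M * `|b - a| ^+ 3.
Proof.
move=> d1 d2 d3 f3M; have M0 : 0 <= M by apply: le_trans (f3M 0).
pose g z := f z - f1 a * z - f2 a / 2 * (z - a) ^+ 2.
have -> : f b - f a - f1 a * (b - a) - f2 a / 2 * (b - a) ^+ 2 = g b - g a.
  by rewrite /g; ring.
rewrite exprSr mulrA.
apply: (mean_value_bound _ (fun z => f1 z - f1 a - f2 a * (z - a))) => z zab.
split; first by apply: is_derive_eq; rewrite /GRing.scale/=; field.
apply: le_trans (_ : M * `|z - a| ^+ 2 <= _).
  by apply: (taylor_order1 _ _ f3) => y _; split.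
by rewrite ler_wpM2l// lerXn2r ?nnegrE ?normr_ge0// between_dist.
Qed.
End taylor.

(** * Heat flow of the Gaussian distribution function *)

Section gaussian.
Context {R : realType} (s : R) (s0 : 0 < s).

Definition normal_cdf (y : R) : R := fine (normal_prob 0 s `]-oo, y]).

Local Notation Psi := normal_cdf.
Local Notation phi := (normal_pdf 0 s).

Lemma normal_probE (y : R) : normal_prob 0 s `]-oo, y] = (Psi y)%:E.
Proof. by rewrite /Psi fineK// fin_num_measure. Qed.

Lemma normal_cdf_ge0 y : 0 <= Psi y.
Proof. by rewrite -lee_fin -normal_probE. Qed.

Lemma normal_cdf_le1 y : Psi y <= 1.
Proof. by rewrite -lee_fin -normal_probE probability_le1. Qed.

Lemma normal_cdf_le x y : x <= y -> Psi x <= Psi y.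
Proof.
move=> xy; rewrite -lee_fin -!normal_probE le_measure ?inE//.
exact: subitvPr.
Qed.

Let id_rv : measurableTypeR R -> R := idfun.

#[local] HB.instance Definition _ :=
  @isMeasurableFun.Build _ _ _ _ id_rv (@measurable_id _ _ setT).

Lemma normal_cdf_cvg :
  (Psi y @[y --> -oo] --> (0 : R)) /\ (Psi y @[y --> +oo] --> (1 : R)).
Proof.
split; apply: fine_cvg.
- exact: (cvg_cdfNy0 (id_rv : {RV normal_prob 0 s >-> R})).
- exact: (cvg_cdfy1 (id_rv : {RV normal_prob 0 s >-> R})).
Qed.

Lemma is_derive_normal_cdf (y : R) : is_derive y 1 Psi (phi y).
Proof.
have int : lebesgue_measure.-integrable [set` Interval -oo%O (BRight (y + 1))]
    (EFin \o phi).
  by apply: (integrableS _ _ (subsetT _)) => //; exact: integrable_normal_pdf.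
have [d dE] := @continuous_FTC1 R phi -oo%O y (y + 1) ltac:(by rewrite ltrDl)
  int (ltNyr _) (@continuous_normal_pdf R 0 s (lt0r_neq0 s0) y).
rewrite (_ : Psi = fun x => (\int[lebesgue_measure]_(t in
    [set` Interval -oo%O (BRight x)]) phi t)%R); last first.
  by apply/funext => z; rewrite /normal_cdf /normal_prob /Rintegral.
by apply: (DeriveDef d); rewrite -derive1E.
Qed.

Lemma continuous_normal_cdf : continuous Psi.
Proof.
move=> y; apply/differentiable_continuous/derivable1_diffP.
exact: (@ex_derive _ _ _ _ _ _ _ (is_derive_normal_cdf y)).
Qed.

Lemma is_derive_normal_pdf (y : R) : is_derive y 1 phi (- (y / s ^+ 2) * phi y).
Proof.
rewrite normal_pdfE ?lt0r_neq0// /normal_fun.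
have -> : (fun x : R => normal_peak s * expR (- (x - 0) ^+ 2 / (s ^+ 2 *+ 2)))
  = (fun x : R => normal_peak s * expR (- (s ^+ 2 *+ 2)^-1 * (x ^+ 2))).
  by apply/funext => x; rewrite subr0; congr (_ * expR _); ring.
apply: is_derive_eq.
rewrite /GRing.scale/= !subr0 -mulr_natr.
have -> : - y ^+ 2 / (s ^+ 2 * 2) = - (s ^+ 2 * 2)^-1 * y ^+ 2 by ring.
by field; rewrite lt0r_neq0.
Qed.

(** The derivatives used below are polynomials of degree at most 3 times the
    density, so one bound against a polynomial of degree 4 controls them all. It
    comes from squaring 1 + z <= exp z, where z is half of the exponent. *)
Lemma normal_pdf_decay :
  {C : R | 0 <= C & forall y : R, phi y * (1 + y ^+ 2) ^+ 2 <= C}.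
Proof.
pose K := 1 + 4 * s ^+ 2.
have K0 : 0 <= K by rewrite /K; nra.
have P0 := normal_peak_ge0 s.
exists (normal_peak s * K ^+ 2) => [|y].
  by rewrite mulr_ge0// sqr_ge0.
rewrite normal_pdfE ?lt0r_neq0// /normal_fun subr0 -mulrA ler_wpM2l//.
set z := y ^+ 2 / (4 * s ^+ 2).
have z0 : 0 <= z by rewrite divr_ge0 ?sqr_ge0// mulr_ge0 ?sqr_ge0.
have -> : - y ^+ 2 / (s ^+ 2 *+ 2) = - (2 * z).
  by rewrite /z; field; rewrite lt0r_neq0.
rewrite expRN mulrC ler_pdivrMr ?expR_gt0//.
have -> : expR (2 * z) = expR z ^+ 2 by rewrite -expRM_natl.
rewrite -exprMn lerXn2r ?nnegrE ?mulr_ge0 ?expR_ge0//.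
  by rewrite addr_ge0// sqr_ge0.
apply: le_trans (_ : K * (1 + z) <= _); last first.
  by rewrite ler_wpM2l// expR_ge1Dx.
have -> : K * (1 + z) = 1 + y ^+ 2 + z + 4 * s ^+ 2.
  by rewrite /K /z; field; rewrite lt0r_neq0.
by have := sqr_ge0 s; lra.
Qed.

Let phi' (y : R) := - (y / s ^+ 2) * phi y.
Let phi'' (y : R) := (y ^+ 2 / s ^+ 4 - s ^- 2) * phi y.

Let is_derive_phi' (y : R) : is_derive y 1 phi' (phi'' y).
Proof.
have := is_derive_normal_pdf y => d.
rewrite /phi' /phi''; apply: is_derive_eq; rewrite /GRing.scale/=.
by field; rewrite lt0r_neq0.
Qed.

(** As a function of b and t, heat solves heat_t = (s^2 / 2) heat_bb: it is the
    probability that b plus a centred Gaussian of variance s^2 t is at least 0.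
    heat' and heat'' are its first two derivatives in t. *)
Let heat (b t : R) := Psi (b / Num.sqrt t).
Let heat' (b t : R) := - (b / Num.sqrt t) * phi (b / Num.sqrt t) / (2 * t).
Let heat'' (b t : R) := let y := b / Num.sqrt t in
  phi y * y * (3 / 4 - y ^+ 2 / (4 * s ^+ 2)) / t ^+ 2.

Let is_derive_div_sqrt (b t : R) : 0 < t ->
  is_derive t 1 (fun t => b / Num.sqrt t) (- (b / Num.sqrt t) / (2 * t)).
Proof.
move=> t0; have q0 : 0 < Num.sqrt t by rewrite sqrtr_gt0.
have d := is_derive1_sqrt t0.
have dV := @is_deriveV _ _ _ _ _ (lt0r_neq0 q0) d.
apply: is_derive_eq; rewrite /GRing.scale/=.
have tE : t = Num.sqrt t ^+ 2 by rewrite sqr_sqrtr// ltW.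
move: (Num.sqrt t) tE q0 {d dV} => c -> c0.
by field; rewrite lt0r_neq0.
Qed.

Let is_derive_heat (b t : R) : 0 < t -> is_derive t 1 (heat b) (heat' b t).
Proof.
move=> t0; have d := is_derive_div_sqrt b t t0.
have dP := is_derive_normal_cdf (b / Num.sqrt t).
apply: is_derive_eq.
by rewrite /heat'/=; ring.
Qed.

Let is_derive_heat' (b t : R) : 0 < t -> is_derive t 1 (heat' b) (heat'' b t).
Proof.
move=> t0; have d := is_derive_div_sqrt b t t0.
have dP := is_derive_normal_pdf (b / Num.sqrt t).
have dphi : is_derive t 1 (fun t => phi (b / Num.sqrt t)) _ :=
  @is_derive1_comp R phi (fun t => b / Num.sqrt t) t _ _ dP d.
have t2 : (2 * t : R) != 0 by rewrite mulf_neq0// lt0r_neq0.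
have dt : is_derive t 1 (fun t : R => 2 * t) 2.
  by apply: is_derive_eq; rewrite /GRing.scale/=; ring.
have dV := is_deriveV t2 dt.
rewrite /heat'; apply: is_derive_eq; rewrite /GRing.scale/=.
clear d dP dphi dV; rewrite /heat''/=; move: (b / Num.sqrt t) => y.
by move: (phi y) => q; field; rewrite !lt0r_neq0.
Qed.

(** The engine of the central limit theorem. Averaging over one centred Bernoulli
    step of variance r^2 p (1 - p) adds half of that variance times the second
    space derivative; by the heat equation this is, to first order, what adding
    h to the time does. The time is kept above t0, where the derivatives that
    control the two Taylor remainders are bounded. *)
Lemma heat_step : {C : R | forall p r h b t t0 : R,
  0 <= p <= 1 -> h = r ^+ 2 * (p * (1 - p)) / s ^+ 2 ->
  0 < t0 -> t0 <= t ->
  `|p * Psi ((b + (1 - p) * r) / Num.sqrt t)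
    + (1 - p) * Psi ((b - p * r) / Num.sqrt t) - Psi (b / Num.sqrt (t + h))|
  <= C * ((`|r| / Num.sqrt t0) ^+ 3 + (h / t0) ^+ 2)}.
Proof.
have [C C0 phiC] := normal_pdf_decay.
pose M := C * (s ^- 4 + s ^- 2).
pose N := C * (1 + s ^- 2).
have i2 : 0 <= s ^- 2 by rewrite invr_ge0 sqr_ge0.
have i4 : 0 <= s ^- 4 by rewrite invr_ge0 exprn_ge0// ltW.
have M0 : 0 <= M by rewrite mulr_ge0 ?addr_ge0.
have N0 : 0 <= N by rewrite mulr_ge0 ?addr_ge0.
have phi''M y : `|phi'' y| <= M.
  rewrite /phi'' normrM (ger0_norm (normal_pdf_ge0 _ _ _)) /M mulrC.
  have p0 := normal_pdf_ge0 0 s y.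
  apply: le_trans (_ : phi y * ((1 + y ^+ 2) ^+ 2 * (s ^- 4 + s ^- 2)) <= _).
    rewrite ler_wpM2l// (le_trans (ler_normB _ _))//.
    rewrite (ger0_norm i2) (ger0_norm (mulr_ge0 (sqr_ge0 y) i4)).
    have := sqr_ge0 y; nra.
  by rewrite mulrA ler_wpM2r ?addr_ge0.
have heat''N b t : 0 < t -> `|heat'' b t| <= N / t ^+ 2.
  move=> t0; rewrite /heat''; set y := b / _.
  have p0 := normal_pdf_ge0 0 s y.
  rewrite normrM [X in _ * X]ger0_norm; last by rewrite invr_ge0 sqr_ge0.
  rewrite ler_wpM2r ?invr_ge0 ?sqr_ge0// -mulrA normrM (ger0_norm p0).
  apply: le_trans (_ : phi y * ((1 + y ^+ 2) ^+ 2 * (1 + s ^- 2)) <= _).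
    rewrite ler_wpM2l// normrM.
    have -> : (1 + y ^+ 2) ^+ 2 * (1 + s ^- 2)
      = (1 + y ^+ 2) * ((1 + y ^+ 2) * (1 + s ^- 2)) by ring.
    have y2 := sqr_ge0 y.
    have yy : `|y| <= 1 + y ^+ 2.
      by rewrite -real_normK ?num_real//; have := sqr_ge0 (`|y| - 1); nra.
    apply: ler_pM => //.
    rewrite (le_trans (ler_normB _ _))//.
    have -> : y ^+ 2 / (4 * s ^+ 2) = y ^+ 2 * s ^- 2 / 4.
      by field; rewrite lt0r_neq0.
    have ys := mulr_ge0 y2 i2.
    by rewrite !ger0_norm; nra.
  by rewrite mulrA ler_wpM2r ?addr_ge0.
exists (M + N) => p r h b t t0 p01 hE t00 t0t.
have [p0 p1] := andP p01.
have tp : 0 < t by exact: lt_le_trans t0t.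
have h0 : 0 <= h.
  by rewrite hE divr_ge0 ?sqr_ge0// mulr_ge0 ?sqr_ge0// mulr_ge0// subr_ge0.
have c0 : 0 < Num.sqrt t by rewrite sqrtr_gt0.
have e0 : 0 < Num.sqrt t0 by rewrite sqrtr_gt0.
have e0c : Num.sqrt t0 <= Num.sqrt t by rewrite ler_wsqrtr.
pose rho := r / Num.sqrt t; pose y := b / Num.sqrt t.
have T k := @taylor_order2 R Psi phi phi' phi'' M y (y + k)
  is_derive_normal_cdf is_derive_normal_pdf is_derive_phi' phi''M.
have rhoM : `|rho| <= `|r| / Num.sqrt t0.
  rewrite /rho normrM ler_wpM2l// gtr0_norm ?invr_gt0//.
  by rewrite lef_pV2.
have Q k : `|k| <= 1 -> `|Psi (y + k * rho) - Psi y - phi y * (k * rho)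
    - phi' y / 2 * (k * rho) ^+ 2| <= M * (`|r| / Num.sqrt t0) ^+ 3.
  move=> k1; have := T (k * rho); rewrite (addrAC y) subrr add0r.
  move=> /le_trans; apply.
  rewrite ler_wpM2l// lerXn2r ?nnegrE ?divr_ge0 ?sqrtr_ge0//.
  by rewrite normrM (le_trans _ rhoM)// ler_piMl.
have V : `|heat b (t + h) - heat b t - heat' b t * h| <= N * (h / t0) ^+ 2.
  have := @taylor_order1 R (heat b) (heat' b) (heat'' b) t (t + h) (N / t0 ^+ 2).
  rewrite (addrAC t) subrr add0r (ger0_norm h0) => V.
  have -> : N * (h / t0) ^+ 2 = N / t0 ^+ 2 * h ^+ 2 by rewrite expr_div_n; ring.
  apply: V => z.
  have th : t <= t + h by rewrite lerDl.
  rewrite (min_idPl th) => /andP[tz _].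
  have z0 : 0 < z by exact: lt_le_trans tz.
  split; [exact: is_derive_heat|exact: is_derive_heat'|].
  apply: le_trans (heat''N b z z0) _.
  rewrite ler_wpM2l// lef_pV2 ?posrE ?exprn_gt0//.
  by rewrite lerXn2r ?nnegrE ?(le_trans t0t)// ltW.
have -> : (b + (1 - p) * r) / Num.sqrt t = y + (1 - p) * rho.
  by rewrite /y /rho; ring.
have -> : (b - p * r) / Num.sqrt t = y + - p * rho by rewrite /y /rho; ring.
rewrite -/(heat b (t + h)).
have E1 := Q (1 - p) ltac:(by rewrite ger0_norm; lra).
have E2 := Q (- p) ltac:(by rewrite normrN ger0_norm; lra).
set e := (_ / _) ^+ 3 in E1 E2 *.
set A := Psi _ - _ - _ - _ in E1; set B := Psi _ - _ - _ - _ in E2.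
set D := _ - _ - _ in V.
(* The heat equation, which cancels the second-order terms. *)
have heat'E : heat' b t * h = phi' y / 2 * (p * (1 - p) * rho ^+ 2).
  rewrite /heat' -/y /phi' /rho hE expr_div_n (sqr_sqrtr (ltW tp)).
  by field; rewrite !lt0r_neq0.
have -> : p * Psi (y + (1 - p) * rho) + (1 - p) * Psi (y + - p * rho)
    - heat b (t + h) = p * A + (1 - p) * B - D.
  by rewrite /D heat'E /A /B /heat -/y; ring.
have e0' : 0 <= e by rewrite exprn_ge0// divr_ge0// ltW.
have g0 : 0 <= (h / t0) ^+ 2 by exact: sqr_ge0.
apply: le_trans (_ : p * (M * e) + (1 - p) * (M * e) + N * (h / t0) ^+ 2 <= _).
  rewrite (le_trans (ler_normB _ _))// lerD// (le_trans (ler_normD _ _))//.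
  by rewrite lerD// normrM ger0_norm ?subr_ge0// ler_wpM2l// subr_ge0.
move: (_ ^+ 2) g0 => g g0.
have -> : (M + N) * (e + g) = M * e + N * g + (M * g + N * e) by ring.
have := mulr_ge0 M0 g0; have := mulr_ge0 N0 e0'; lra.
Qed.
End gaussian.

(** * Replacing binomial steps by Gaussian ones *)

Section binomial.
Context {R : realType}.
Implicit Types (n k : nat) (p : R) (g : nat -> R).

Definition binomial_mean n p g : R :=
  \sum_(k < n.+1) ('C(n, k)%:R * (p ^+ k * (1 - p) ^+ (n - k))) * g k.

(** Pascal's rule, read as conditioning on the first of n + 1 coin tosses; it
    lets the walk be replaced one step at a time. *)
Lemma binomial_meanS n p g : binomial_mean n.+1 p g =
  p * binomial_mean n p (fun k => g k.+1) + (1 - p) * binomial_mean n p g.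
Proof.
rewrite /binomial_mean; set q := 1 - p.
have -> : \sum_(k < n.+1) ('C(n, k)%:R * (p ^+ k * q ^+ (n - k))) * g k =
  \sum_(k < n.+2) ('C(n, k)%:R * (p ^+ k * q ^+ (n - k))) * g k.
  by rewrite [RHS]big_ord_recr/= bin_small// !mul0r addr0.
rewrite big_ord_recl [X in _ + q * X]big_ord_recl mulrDr addrCA; congr (_ + _).
  by rewrite !bin0 !subn0 exprS; ring.
rewrite !mulr_sumr -big_split; apply: eq_bigr => k _ /=.
rewrite !/bump/= !add1n binS natrD subSS exprS.
case: (ltnP k n) => kn; first by rewrite -(subnSK kn) exprS; ring.
by rewrite (@bin_small n k.+1) ?ltnS//; ring.
Qed.

Lemma le_binomial_mean n p g1 g2 : 0 <= p <= 1 -> (forall k, g1 k <= g2 k) ->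
  binomial_mean n p g1 <= binomial_mean n p g2.
Proof.
move=> /andP[p0 p1] g12; apply: ler_sum => k _; rewrite ler_wpM2l//.
by rewrite !mulr_ge0 ?exprn_ge0 ?subr_ge0.
Qed.

Lemma binomial_mean_cst n p a : binomial_mean n p (fun=> a) = a.
Proof.
elim: n => [|n IH]; first by rewrite /binomial_mean big_ord1 bin0 !expr0; ring.
by rewrite binomial_meanS IH; ring.
Qed.

Lemma binomial_meanDl n p g a :
  binomial_mean n p (fun k => g k + a) = binomial_mean n p g + a.
Proof.
rewrite -[in RHS](binomial_mean_cst n p a) -big_split.
by apply: eq_bigr => k _; rewrite mulrDr.
Qed.

Lemma binomial_meanZr n p g a :
  binomial_mean n p (fun k => g k * a) = binomial_mean n p g * a.
Proof. by rewrite mulr_suml; apply: eq_bigr => k _; rewrite mulrA. Qed.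

(** Lindeberg's telescoping argument: if one step of the walk costs h units of
    time up to an error e, uniformly in the position, then n steps cost n h
    units up to n e. *)
Lemma lindeberg_binomial (u : R -> R -> R) p r h e t0 :
  0 <= p <= 1 -> 0 <= h ->
  (forall t w, t0 <= t ->
    `|p * u t (w + (1 - p) * r) + (1 - p) * u t (w - p * r) - u (t + h) w|
      <= e) ->
  forall n w,
    `|binomial_mean n p (fun k => u t0 (w + r * (k%:R - n%:R * p)))
      - u (t0 + n%:R * h) w| <= n%:R * e.
Proof.
move=> p01 h0 step; elim=> [|n IH] w.
  rewrite /binomial_mean big_ord1 bin0 !mul0r !expr0 subrr !mulr0 !addr0.
  by rewrite mulr1 !mul1r subrr normr0.
rewrite binomial_meanS.
have t0n : t0 <= t0 + n%:R * h by rewrite lerDl mulr_ge0.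
have := step (t0 + n%:R * h) w t0n.
have := IH (w - p * r); have := IH (w + (1 - p) * r).
have -> : (fun k => u t0 (w + r * (k.+1%:R - n.+1%:R * p))) =
  (fun k => u t0 (w + (1 - p) * r + r * (k%:R - n%:R * p))).
  by apply/funext => k; congr (u _ _); rewrite -!natr1; ring.
have -> : (fun k => u t0 (w + r * (k%:R - n.+1%:R * p))) =
  (fun k => u t0 (w - p * r + r * (k%:R - n%:R * p))).
  by apply/funext => k; congr (u _ _); rewrite -!natr1; ring.
have -> : t0 + n.+1%:R * h = t0 + n%:R * h + h by rewrite -natr1; ring.
set A := binomial_mean _ _ _; set B := binomial_mean _ _ _.
set a := u _ _; set b := u _ _; set c := u _ _ => Aa Bb abc.
have -> : p * A + (1 - p) * B - c =
  p * (A - a) + (1 - p) * (B - b) + (p * a + (1 - p) * b - c) by ring.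
have [p0 p1] := andP p01.
have -> : n.+1%:R * e = p * (n%:R * e) + (1 - p) * (n%:R * e) + e.
  by rewrite -natr1; ring.
rewrite (le_trans (ler_normD _ _))// lerD//.
rewrite (le_trans (ler_normD _ _))// !normrM (ger0_norm p0).
by rewrite (ger0_norm (_ : 0 <= 1 - p)) ?subr_ge0// lerD// ler_wpM2l ?subr_ge0.
Qed.

End binomial.

(** * Central limit theorem for binomial tails *)

Section clt.
Context {R : realType}.
Implicit Types (n k : nat).

(** The indicator of c <= k is compared with Psi ((x +- 2 dl + w) / dl^2), where
    w = r (k - n p) is the centred and rescaled count and Psi is the normal
    distribution function. The threshold sits within dl of w = - x; beyond it the
    shift 2 dl leaves a margin dl, which after division by dl^2 is the argument
    1 / dl of the error terms. The flow starts at time dl^4 so that sqrt t is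
    dl^2 there. *)
Lemma binomial_tail_bounds {s : R} (s0 : 0 < s) :
  {C : R | forall n (p r h c x dl : R),
    0 <= p <= 1 -> 0 < r -> h = r ^+ 2 * (p * (1 - p)) / s ^+ 2 -> 0 < dl ->
    `|r * (c - n%:R * p) + x| <= dl ->
    let tail := binomial_mean n p (fun k => if c <= k%:R then 1 else 0) in
    let err := n%:R * (C * ((r / dl ^+ 2) ^+ 3 + (h / dl ^+ 4) ^+ 2)) in
    let Phi b := normal_cdf s (b / Num.sqrt (dl ^+ 4 + n%:R * h)) in
    tail * normal_cdf s dl^-1 <= Phi (x + 2 * dl) + err /\
    Phi (x - 2 * dl) <= tail + normal_cdf s (- dl^-1) + err}.
Proof.
have [C step] := heat_step s s0.
exists C => n p r h c x dl p01 r0 hE dl0 cx tail err Phi.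
have [p0 p1] := andP p01.
have h0 : 0 <= h.
  by rewrite hE divr_ge0 ?sqr_ge0// mulr_ge0 ?sqr_ge0// mulr_ge0// subr_ge0.
have dl4 : 0 < dl ^+ 4 by rewrite exprn_gt0.
have sq4 : Num.sqrt (dl ^+ 4) = dl ^+ 2.
  by rewrite (exprM dl 2 2) sqrtr_sqr ger0_norm// sqr_ge0.
pose u b t w := normal_cdf s ((b + w) / Num.sqrt t).
have L b : `|binomial_mean n p (fun k => u b (dl ^+ 4) (r * (k%:R - n%:R * p)))
    - Phi b| <= err.
  have := @lindeberg_binomial R (u b) p r h
    (C * ((r / dl ^+ 2) ^+ 3 + (h / dl ^+ 4) ^+ 2)) (dl ^+ 4) p01 h0 _ n 0.
  rewrite /u addr0; under eq_fun do rewrite add0r.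
  apply=> t w tdl.
  have := step p r h (b + w) t (dl ^+ 4) p01 hE dl4 tdl.
  by rewrite sq4 (gtr0_norm r0) -!addrA.
have atail k : (c <= k%:R) -> - x - dl <= r * (k%:R - n%:R * p).
  move=> ck; apply: le_trans (_ : r * (c - n%:R * p) <= _).
    by move: cx; rewrite ler_norml; lra.
  by rewrite ler_wpM2l ?(ltW r0)// lerD2r.
have btail k : (k%:R < c) -> r * (k%:R - n%:R * p) <= - x + dl.
  move=> ck; apply: le_trans (_ : r * (c - n%:R * p) <= _).
    by rewrite ler_wpM2l ?(ltW r0)// lerD2r ltW.
  by move: cx; rewrite ler_norml; lra.
have dlV : dl^-1 = dl / dl ^+ 2 by field; rewrite lt0r_neq0.
have i2 : 0 <= (dl ^+ 2)^-1 by rewrite invr_ge0 sqr_ge0.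
split.
  have := L (x + 2 * dl); rewrite ler_distl => /andP[_]; apply: le_trans.
  rewrite -binomial_meanZr; apply: le_binomial_mean => // k.
  rewrite /u sq4; case: (leP c) => ck; rewrite ?mul1r ?mul0r ?normal_cdf_ge0//.
  by apply: normal_cdf_le; rewrite dlV ler_wpM2r//; have := atail k ck; lra.
have := L (x - 2 * dl); rewrite ler_distl => /andP[+ _].
rewrite lerBlDr => /le_trans; apply; rewrite lerD2r -binomial_meanDl.
apply: le_binomial_mean => // k.
rewrite /u sq4; case: (leP c) => ck.
  by apply: (le_trans (normal_cdf_le1 _ _)); rewrite lerDl normal_cdf_ge0.
rewrite add0r; apply: normal_cdf_le; rewrite dlV -[- (dl / _)]mulNr ler_wpM2r//.
by have := btail k ck; lra.
Qed.

Let squeeze_errors (e L m A B T1 T2 P1 P2 err : R) :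
  m <= 1 -> A <= 1 -> `|1 - A| <= e / 4 -> `|0 - B| <= e / 4 ->
  `|L - T1| <= e / 4 -> `|L - T2| <= e / 4 ->
  `|T1 - P1| <= e / 4 -> `|T2 - P2| <= e / 4 -> `|0 - err| <= e / 4 ->
  m * A <= P1 + err -> P2 <= m + B + err -> `|L - m| <= e.
Proof.
move=> m1 A1; rewrite !ler_norml.
move=> /andP[_ dA] /andP[dB _] /andP[d1 _] /andP[_ d2] /andP[e1 _] /andP[_ e2].
move=> /andP[f1 f2] up low.
have mA : 0 <= (1 - m) * (1 - A) by rewrite mulr_ge0 ?subr_ge0.
rewrite (_ : (1 - m) * (1 - A) = 1 - m - A + m * A) in mA; last by ring.
by apply/andP; split; lra.
Qed.

Lemma cvg_invn : (n%:R^-1 : R) @[n --> \oo] --> (0 : R).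
Proof.
apply/gtr0_cvgV0; last exact: cvgr_idn.
by near=> n; rewrite ltr0n; near: n; exact: nbhs_infty_gt.
Unshelve. all: by end_near. Qed.

Lemma cvg_inv_sqrtn : ((Num.sqrt n%:R)^-1 : R) @[n --> \oo] --> (0 : R).
Proof.
rewrite -[X in _ --> X](@sqrtr0 R).
under eq_cvg do rewrite -sqrtrV ?ler0n//.
by apply: continuous_cvg; [exact: sqrt_continuous|exact: cvg_invn].
Qed.

(** A central limit theorem for binomial laws whose parameter p n varies with n.
    For a fixed smoothing parameter dl the bounds of binomial_tail_bounds converge
    as n grows, since n steps take a total time tending to 1; then dl tends
    to 0. *)
Lemma binomial_clt (kappa p0 x : R) (p c : nat -> R) :
  0 < kappa -> 0 < p0 < 1 -> (forall n, 0 <= p n <= 1) ->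
  p n @[n --> \oo] --> p0 ->
  (kappa / Num.sqrt n%:R) * (c n - n%:R * p n) @[n --> \oo] --> - x ->
  binomial_mean n (p n) (fun k => if c n <= k%:R then 1 else 0)
    @[n --> \oo] --> normal_cdf (kappa * Num.sqrt (p0 * (1 - p0))) x.
Proof.
move=> kappa0 /andP[p00 p01] p1 pp0 cx.
set s := kappa * _; set Psi := normal_cdf s.
have v0 : 0 < p0 * (1 - p0) by rewrite mulr_gt0// subr_gt0.
have s0 : 0 < s by rewrite mulr_gt0// sqrtr_gt0.
have s2 : s ^+ 2 = kappa ^+ 2 * (p0 * (1 - p0)).
  by rewrite /s exprMn sqr_sqrtr// ltW.
have [C tail] := binomial_tail_bounds s0.
(* The total time taken by the n steps. *)
pose a n := p n * (1 - p n) / (p0 * (1 - p0)).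
have a1 : a n @[n --> \oo] --> (1 : R).
  suff : a n @[n --> \oo] --> p0 * (1 - p0) / (p0 * (1 - p0)).
    by rewrite divff// lt0r_neq0.
  apply: cvgM; last exact: cvg_cst.
  by apply: cvgM => //; apply: cvgB => //; exact: cvg_cst.
have cPsi := continuous_normal_cdf s s0.
have [PsiN PsiP] := normal_cdf_cvg s.
apply/cvgrPdist_le => e e0; have e4 : 0 < e / 4 by rewrite divr_gt0.
have right0 : (dl : R) @[dl --> (0 : R)^'+] --> (0 : R).
  by apply: cvg_at_right_filter; exact: cvg_id.
have invy : dl^-1 @[dl --> (0 : R)^'+] --> +oo.
  by apply/cvgrVy => //; exact: nbhs_right_gt.
have H1 : \forall dl \near (0 : R)^'+, `|1 - Psi dl^-1| <= e / 4.
  by move: (cvg_comp _ _ invy PsiP) => /cvgrPdist_le; exact.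
have H2 : \forall dl \near (0 : R)^'+, `|0 - Psi (- dl^-1)| <= e / 4.
  have invNy : - dl^-1 @[dl --> (0 : R)^'+] --> -oo.
    exact/cvgNrNy.
  by move: (cvg_comp _ _ invNy PsiN) => /cvgrPdist_le; exact.
have H3 z : \forall dl \near (0 : R)^'+,
    `|Psi x - Psi ((x + z * dl) / Num.sqrt (dl ^+ 4 + 1))| <= e / 4.
  have : (x + z * dl) / Num.sqrt (dl ^+ 4 + 1) @[dl --> (0 : R)^'+] --> x.
    suff : (x + z * dl) / Num.sqrt (dl ^+ 4 + 1) @[dl --> (0 : R)^'+] -->
        (x + z * 0) / Num.sqrt (0 ^+ 4 + 1).
      by rewrite mulr0 addr0 expr0n add0r sqrtr1 divr1.
    apply: cvgM.
      by apply: cvgD; [exact: cvg_cst|apply: cvgM => //; exact: cvg_cst].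
    apply: cvgV; first by rewrite expr0n add0r sqrtr1.
    apply: continuous_cvg; first exact: sqrt_continuous.
    apply: cvgD; last exact: cvg_cst.
    exact: (continuous_cvg _ (@exprn_continuous R 4 0) right0).
  by move=> /(continuous_cvg _ (cPsi x))/cvgrPdist_le; exact.
have H32 := H3 2; have H3N2 := H3 (- 2).
near (0 : R)^'+ => dl.
have dl0 : 0 < dl by near: dl; exact: nbhs_right_gt.
have d1 : `|1 - Psi dl^-1| <= e / 4 by near: dl.
have d2 : `|0 - Psi (- dl^-1)| <= e / 4 by near: dl.
have d3 : `|Psi x - Psi ((x + 2 * dl) / Num.sqrt (dl ^+ 4 + 1))| <= e / 4.
  by near: dl.
have d4 : `|Psi x - Psi ((x + - 2 * dl) / Num.sqrt (dl ^+ 4 + 1))| <= e / 4.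
  by near: dl.
pose err n := C * ((kappa / dl ^+ 2) ^+ 3 * (Num.sqrt n%:R)^-1
  + (a n / dl ^+ 4) ^+ 2 * n%:R^-1).
have err0 : err n @[n --> \oo] --> (0 : R).
  suff : err n @[n --> \oo] -->
      C * ((kappa / dl ^+ 2) ^+ 3 * 0 + (1 / dl ^+ 4) ^+ 2 * 0).
    by rewrite !mulr0 addr0 mulr0.
  apply: cvgM; first exact: cvg_cst.
  apply: cvgD; apply: cvgM; [exact: cvg_cst|exact: cvg_inv_sqrtn| |exact: cvg_invn].
  have ad : a n / dl ^+ 4 @[n --> \oo] --> 1 / dl ^+ 4.
    by apply: cvgM => //; exact: cvg_cst.
  exact: (continuous_cvg _ (@exprn_continuous R 2 _) ad).
have dl4 : 0 < dl ^+ 4 by rewrite exprn_gt0.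
have Ha z : Psi ((x + z * dl) / Num.sqrt (dl ^+ 4 + a n)) @[n --> \oo] -->
  Psi ((x + z * dl) / Num.sqrt (dl ^+ 4 + 1)).
  apply: continuous_cvg; first exact: cPsi.
  apply: cvgM; first exact: cvg_cst.
  apply: cvgV; first by rewrite lt0r_neq0// sqrtr_gt0 addr_gt0.
  apply: continuous_cvg; first exact: sqrt_continuous.
  by apply: cvgD => //; exact: cvg_cst.
have H4 : \forall n \near \oo, `|0 - err n| <= e / 4.
  by move: err0 => /cvgrPdist_le; exact.
have H5 : \forall n \near \oo,
    `|- x - kappa / Num.sqrt n%:R * (c n - n%:R * p n)| <= dl.
  by move: cx => /cvgrPdist_le; exact.
have H6 z : \forall n \near \oo, `|Psi ((x + z * dl) / Num.sqrt (dl ^+ 4 + 1))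
    - Psi ((x + z * dl) / Num.sqrt (dl ^+ 4 + a n))| <= e / 4.
  by move: (Ha z) => /cvgrPdist_le; exact.
have H62 := H6 2; have H6N2 := H6 (- 2).
near=> n.
have n0 : (0 < n)%N by near: n; exact: nbhs_infty_gt.
have nR0 : 0 < n%:R :> R by rewrite ltr0n.
have sn0 : 0 < Num.sqrt n%:R :> R by rewrite sqrtr_gt0.
have sn2 : n%:R = Num.sqrt n%:R ^+ 2 :> R by rewrite sqr_sqrtr// ltW.
have r0 : 0 < kappa / Num.sqrt n%:R by rewrite divr_gt0.
have hE : a n / n%:R =
    (kappa / Num.sqrt n%:R) ^+ 2 * (p n * (1 - p n)) / s ^+ 2.
  rewrite s2 /a expr_div_n -sn2; field.
  by rewrite !lt0r_neq0// ?subr_gt0.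
have cn : `|kappa / Num.sqrt n%:R * (c n - n%:R * p n) + x| <= dl.
  by rewrite -normrN opprD addrC; near: n.
have := tail n (p n) _ (a n / n%:R) (c n) x dl (p1 n) r0 hE dl0 cn.
rewrite /= (mulrC n%:R (_ / n%:R)) divfK ?lt0r_neq0//.
have -> : n%:R * (C * ((kappa / Num.sqrt n%:R / dl ^+ 2) ^+ 3
    + (a n / n%:R / dl ^+ 4) ^+ 2)) = err n.
  rewrite /err; move: (Num.sqrt n%:R) sn0 sn2 => q q0 ->.
  by field; rewrite !lt0r_neq0.
have e1 : `|0 - err n| <= e / 4 by near: n.
have e2 : `|Psi ((x + 2 * dl) / Num.sqrt (dl ^+ 4 + 1))
    - Psi ((x + 2 * dl) / Num.sqrt (dl ^+ 4 + a n))| <= e / 4 by near: n.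
have e3 : `|Psi ((x + - 2 * dl) / Num.sqrt (dl ^+ 4 + 1))
    - Psi ((x + - 2 * dl) / Num.sqrt (dl ^+ 4 + a n))| <= e / 4 by near: n.
set m := binomial_mean _ _ _.
have m1 : m <= 1.
  rewrite -(binomial_mean_cst n (p n) 1); apply: le_binomial_mean => // k.
  by case: ifP.
move=> -[up low]; move: low; rewrite -mulNr => low.
exact: (squeeze_errors _ _ _ _ _ _ _ _ _ _ m1 (normal_cdf_le1 s _)
  d1 d2 d3 d4 e2 e3 e1 up low).
Unshelve. all: by end_near. Qed.
End clt.

(** * The number of observations below a threshold is binomial *)

Definition sublevel {R : realType} {n : nat} (x : 'I_n -> R) (t : R) :
  {set 'I_n} := [set i | x i <= t]%SET.

Section count.
Context {d : measure_display} {T : measurableType d} {R : realType}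
  (P : probability T R) {n : nat} (X : 'I_n -> {RV P >-> R}) (t p : R)
  (indep : mutually_independent X) (cdfX : forall i, cdf (X i) t = p%:E).

Let below (w : T) : {set 'I_n} := sublevel (fun i => X i w) t.

Let measurable_X_le i : measurable (X i @^-1` `]-oo, t]).
Proof. by rewrite -[X in measurable X]setTI; exact: measurable_funP. Qed.

Let prob_X_le i : P (X i @^-1` `]-oo, t]) = p%:E.
Proof. by rewrite -(cdfX i). Qed.

Let cell (J : {set 'I_n}) (i : 'I_n) : set R :=
  if i \in J then [set` `]-oo, t]] else ~` [set` `]-oo, t]].

Let below_cell J : below @^-1` [set J] =
  \bigcap_(i in [set` [set: 'I_n]%SET]) (X i @^-1` cell J i).
Proof.
apply/seteqP; split => w /=.
  move=> <- i _; rewrite /cell/= inE; case: ifP => /=.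
    by rewrite in_itv/=.
  by rewrite in_itv/= => ->.
move=> H; apply/setP => i; rewrite inE.
have := H i; rewrite /= inE => /(_ isT); rewrite /cell.
by case: ifP => iJ /=; rewrite in_itv/=; [|move/negP/negbTE].
Qed.

Let measurable_cell J i : measurable (cell J i).
Proof. by rewrite /cell; case: ifP => _ //; exact: measurableC. Qed.

Let prob_cell J i :
  P (X i @^-1` cell J i) = (if i \in J then p else 1 - p)%:E.
Proof.
rewrite /cell; case: ifP => _ //.
by rewrite -preimage_setC probability_setC// prob_X_le.
Qed.

Lemma measurable_below J : measurable (below @^-1` [set J]).
Proof.
rewrite below_cell; apply: fin_bigcap_measurable => // i _.
by rewrite -[X in measurable X]setTI; exact: measurable_funP.
Qed.

Lemma prob_below J :
  P (below @^-1` [set J]) = (p ^+ #|J| * (1 - p) ^+ (n - #|J|))%:E.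
Proof.
rewrite below_cell indep//; under eq_bigr do rewrite prob_cell.
rewrite prodEFin (bigID (mem J))/=; congr (_ * _)%:E.
  rewrite (eq_bigr (fun=> p)) => [|i /andP[_ ->]//].
  rewrite prodr_const; congr (_ ^+ _); apply: eq_card => i.
  by rewrite [LHS]unfold_in/= inE.
rewrite (eq_bigr (fun=> 1 - p)) => [|i /andP[_ /negbTE ->]//].
rewrite prodr_const; congr (_ ^+ _).
have -> : (n - #|J|)%N = #|[predC J]|.
  by rewrite -(addKn #|J| #|[predC J]|) cardC card_ord.
by apply: eq_card => i; rewrite [LHS]unfold_in/= !inE.
Qed.

Let sum_card (Q : pred nat) :
  \sum_(J : {set 'I_n} | Q #|J|) p ^+ #|J| * (1 - p) ^+ (n - #|J|) =
  binomial_mean n p (fun k => if Q k then 1 else 0).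
Proof.
have cardn (J : {set 'I_n}) : (#|J| < n.+1)%N.
  by rewrite ltnS (leq_trans (max_card _))// card_ord.
rewrite (partition_big (fun J : {set 'I_n} => Ordinal (cardn J)) xpredT)//=.
apply: eq_bigr => k _; case: ifP => Qk; last first.
  rewrite big_pred0 ?mulr0// => J; apply/negP => /andP[QJ /eqP/(congr1 val)/= Jk].
  by move: QJ; rewrite Jk Qk.
rewrite (eq_bigl (fun J => J \in [set J : {set 'I_n} | #|J| == k]%SET)); last first.
  move=> J; rewrite !inE -val_eqE/=.
  by case: (#|J| =P k :> nat) => [->|]; rewrite ?Qk// andbF.
rewrite (eq_bigr (fun=> p ^+ k * (1 - p) ^+ (n - k))); last first.
  by move=> J; rewrite inE => /eqP ->.
by rewrite sumr_const card_draws card_ord mulr1 mulr_natl.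
Qed.

(** The random set of the observations below t takes each value J with the
    product probability given by independence; summing over the sets of equal
    size produces the binomial coefficients. *)
Lemma prob_card_below (Q : pred nat) :
  measurable [set w | Q #|below w|] /\
  P [set w | Q #|below w|] =
    (binomial_mean n p (fun k => if Q k then 1 else 0))%:E.
Proof.
have -> : [set w | Q #|below w|] =
    \bigcup_(J in [set` (fun J : {set 'I_n} => Q #|J|)]) (below @^-1` [set J]).
  apply/seteqP; split => w /=; first by move=> Qw; exists (below w).
  by case=> J /= QJ ->.
split; first by apply: fin_bigcup_measurable => // J _; exact: measurable_below.
rewrite measure_fin_bigcup//; last 2 first.
- by move=> J K _ _ [w [/= <- <-]].
- by move=> J _; exact: measurable_below.
rewrite -(bigfs _ (r := index_enum _)) ?index_enum_uniq//; last first.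
  by move=> J _; rewrite mem_index_enum.
rewrite (eq_bigr _ (fun J _ => prob_below J)).
by rewrite sumEFin sum_card.
Qed.

End count.

(** * Sample quantiles as counts *)

Section order_statistics.
Context {R : realType} {n : nat}.
Implicit Types (x y : 'I_n -> R) (t a : R).

(** The duality that turns a statement about quantiles into one about sums of
    indicators. *)
Lemma order_stat_le x t k : (0 < k <= n)%N ->
  (order_stat x k <= t) = (k <= #|sublevel x t|)%N.
Proof.
move=> /andP[k0 kn]; rewrite /order_stat.
set s := sort _ _.
have s_sorted : sorted <=%R s by exact: sort_le_sorted.
have -> : #|sublevel x t| = count (<= t) s.
  rewrite count_sort count_map -sum1_count big_enum_cond -sum1_card.
  by apply: eq_bigl => i; rewrite inE.
have szs : size s = n by rewrite size_sort size_map size_enum_ord.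
apply/idP/idP => [|kc]; last first.
  by apply: nth_count_le => //; rewrite prednK.
apply: contraTT; rewrite -ltnNge -ltNge => ck.
by apply: nth_count_gt => //; rewrite szs -ltnS !prednK// ck.
Qed.

Lemma sample_rank_bounds a : 0 < a < 1 -> (0 < n)%N ->
  [/\ (0 < `|Num.ceil (n%:R * a)| <= n)%N,
      (0 < `|Num.floor (n%:R * a + 1)| <= n)%N,
      (`|Num.ceil (n%:R * a)| <= `|Num.floor (n%:R * a + 1)|)%N,
      n%:R * a <= (`|Num.ceil (n%:R * a)|%N)%:R &
      (`|Num.floor (n%:R * a + 1)|%N)%:R <= n%:R * a + 1].
Proof.
move=> /andP[a0 a1] n0.
have na0 : 0 < n%:R * a by rewrite mulr_gt0 ?ltr0n.
have nan : n%:R * a < n%:R by rewrite gtr_pMr ?ltr0n.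
move: (n%:R * a) na0 nan => z z0 zn.
have c0 : 0 < Num.ceil z by rewrite ceil_gt0.
have f0 : 0 <= Num.floor z by rewrite floor_ge0 ltW.
have fE : Num.floor (z + 1) = Num.floor z + 1 by rewrite floorDrz ?floor1.
have cn : Num.ceil z <= n%:Z by rewrite ceil_le_int ltW.
have fn : Num.floor z < n%:Z by rewrite floor_lt_int.
have cf : Num.ceil z <= Num.floor z + 1.
  by rewrite ceil_le_int ltW// floorD1_gt.
have zc : z <= (Num.ceil z)%:~R by exact: ceil_ge.
have fz : (Num.floor z)%:~R <= z by exact: floor_le.
rewrite !natr_absz (gtr0_norm c0) fE ger0_norm ?addr_ge0//.
split=> //; last by rewrite intrD lerD2r.
- by lia.
- by lia.
- by lia.
Qed.

Lemma count_ge_of_sample_quantile_le x a t : 0 < a < 1 ->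
  sample_quantile a x <= t -> n%:R * a <= #|sublevel x t|%:R.
Proof.
have [n0|n0] := posnP n.
  by have -> : n%:R = 0 :> R; [rewrite n0|rewrite mul0r].
move=> a01 qt; have [k1n k2n k12 ak _] := sample_rank_bounds a a01 n0.
apply: (le_trans ak); rewrite ler_nat -order_stat_le//.
set k1 := `|_|%N in k1n k12 ak *; set k2 := `|_|%N in k2n k12.
have k1k2 : order_stat x k1 <= order_stat x k2.
  by rewrite order_stat_le// (leq_trans k12)// -order_stat_le.
by apply: le_trans qt; rewrite /sample_quantile -/k1 -/k2; lra.
Qed.

Lemma sample_quantile_le_of_count_ge x a t : 0 < a < 1 -> (0 < n)%N ->
  n%:R * a + 1 <= #|sublevel x t|%:R -> sample_quantile a x <= t.
Proof.
move=> a01 n0 nx; have [k1n k2n k12 _ ka] := sample_rank_bounds a a01 n0.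
set k1 := `|_|%N in k1n k12; set k2 := `|_|%N in k2n k12 ka.
have k2x : (k2 <= #|sublevel x t|)%N by rewrite -(ler_nat R) (le_trans ka).
have o1 : order_stat x k1 <= t by rewrite order_stat_le// (leq_trans k12).
have o2 : order_stat x k2 <= t by rewrite order_stat_le.
by rewrite /sample_quantile -/k1 -/k2; lra.
Qed.

Lemma card_le_changed x y (S : {set 'I_n}) t :
  (forall i, i \notin S -> y i = x i) ->
  (#|sublevel y t| <= #|sublevel x t| + #|S|)%N.
Proof.
move=> yx.
apply: leq_trans (_ : #|(sublevel x t :|: S)%SET| <= _)%N; last first.
  by rewrite cardsU leq_subr.
apply/subset_leq_card/fintype.subsetP => i; rewrite !inE.
by case: (boolP (i \in S)) => [|/yx ->]; rewrite ?orbT ?orbF.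
Qed.

(** Contamination shifts the count by at most #|S|, and the rounding of the two
    ranks by at most 1. *)
Lemma sample_quantile_changed x y (S : {set 'I_n}) a t :
  0 < a < 1 -> (0 < n)%N -> (forall i, i \notin S -> y i = x i) ->
  (n%:R * a + (#|S|%:R + 1) <= #|sublevel x t|%:R -> sample_quantile a y <= t) /\
  (sample_quantile a y <= t -> n%:R * a - #|S|%:R <= #|sublevel x t|%:R).
Proof.
move=> a01 n0 yx; split=> [xt|/(count_ge_of_sample_quantile_le _ _ _ a01) yt].
  apply: sample_quantile_le_of_count_ge => //.
  have := card_le_changed y x S t (fun i iS => esym (yx i iS)).
  by rewrite -(ler_nat R) natrD; lra.
by have := card_le_changed x y S t yx; rewrite -(ler_nat R) natrD; lra.
Qed.

End order_statistics.

(** * The distribution function near its quantile *)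

Section quantile.
Context {R : realType}.

Lemma is_derive_density (F f : R -> R) x : is_density F f ->
  {for x, continuous f} -> is_derive x 1 F (f x).
Proof.
move=> [mf f0 FE] cf.
have int : lebesgue_measure.-integrable [set` Interval -oo%O (BRight (x + 1))]
    (EFin \o f).
  apply/integrableP; split.
    by apply/measurable_EFinP; exact: measurable_funTS.
  under eq_integral do rewrite /= ger0_norm//.
  by rewrite -FE ltry.
have [dF dE] := @continuous_FTC1 R f -oo%O x (x + 1) ltac:(by rewrite ltrDl)
  int (ltNyr _) cf.
rewrite (_ : F = fun x => (\int[lebesgue_measure]_(t in
    [set` Interval -oo%O (BRight x)]) f t)%R); last first.
  by apply/funext => z; rewrite /Rintegral -FE.
by apply: (DeriveDef dF); rewrite -derive1E.
Qed.

Lemma quantile_funK (F : R -> R) a : {homo F : x y / x <= y} ->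
  (exists x, a <= F x) -> (exists x, F x < a) ->
  {for quantile_fun F a, continuous F} ->
  F (quantile_fun F a) = a.
Proof.
move=> F_le F_lty F_gtNy; rewrite /quantile_fun.
set A := [set x | a <= F x]; set q := inf A.
have [z Fz] := F_gtNy.
have lbA : lbound A z.
  move=> y /= ay; rewrite leNgt; apply/negP => /ltW/F_le yz.
  by move: (lt_le_trans Fz ay); rewrite ltNge yz.
have infA : has_inf A by split => //; exists z.
move=> cF; apply/eqP; rewrite eq_le; apply/andP.
split; rewrite leNgt; apply/negP => Fq.
  have : \forall y \near q, a < F y by exact: cvgr_gt cF _ Fq.
  move=> /nbhs_ballP[e /= e0 eF].
  have : q <= q - e / 2.
    apply: ge_inf; first by exists z.
    by apply/ltW/eF; rewrite /ball/= opprB addrC subrK gtr0_norm; lra.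
  by lra.
have : \forall y \near q, F y < a by exact: cvgr_lt cF _ Fq.
move=> /nbhs_ballP[e /= e0 eF].
have [y Ay yq] := inf_adherent e0 infA.
have qy : q <= y by apply: ge_inf => //; exists z.
have : F y < a by apply: eF; rewrite /ball/= ltr_distlC; lra.
by rewrite ltNge Ay.
Qed.

(** The derivative in the direction x, along the increments 1 / sqrt n; a null
    direction x is covered. *)
Lemma cvg_scaled_increment (F : R -> R) (q b x : R) : is_derive q 1 F b ->
  Num.sqrt n%:R * (F (q + x / Num.sqrt n%:R) - F q) @[n --> \oo] --> x * b.
Proof.
move=> dF.
have dqx : derivable F q x.
  exact/diff_derivable/derivable1_diffP.
have DE : 'D_x F q = x * b.
  have /derivable1_diffP diffF : derivable F q 1 by exact: ex_derive.
  rewrite deriveE// -[x in LHS]mulr1 -[_ * 1]/(x *: 1) linearZ/= -deriveE//.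
  by rewrite derive_val.
have inv0 : (Num.sqrt n%:R)^-1 @[n --> \oo] --> (0 : R)^'.
  move=> A /cvg_inv_sqrtn nA.
  apply: filterS2 (nbhs_infty_gt 0) nA => n n0; apply.
  by rewrite invr_neq0// lt0r_neq0// sqrtr_gt0 ltr0n.
have := cvg_comp _ _ inv0 dqx.
rewrite -/(derive F q x) DE; apply: cvg_trans; apply: near_eq_cvg.
near=> n => /=.
by rewrite invrK /GRing.scale/= [_^-1 * x]mulrC [_ + q]addrC.
Unshelve. all: by end_near. Qed.

Lemma littleo_sqrt_cvg (l : nat -> nat) :
  ((fun n => (l n)%:R : R^o) =o_\oo (fun n => Num.sqrt n%:R : R^o)) ->
  (l n)%:R / Num.sqrt n%:R @[n --> \oo] --> (0 : R).
Proof.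
move=> /eqoP lo; apply/cvgrPdist_le => e e0.
have := lo e e0; apply: filterS2 (nbhs_infty_gt 0) => n n0 /=.
have sn0 : 0 < Num.sqrt n%:R :> R by rewrite sqrtr_gt0 ltr0n.
by rewrite sub0r normrN normrM normfV (gtr0_norm sn0) ler_pdivrMr.
Qed.
End quantile.

(** * Asymptotic normality *)

Theorem proposition3p33 (R : realType) (alpha : R) (F f : R -> R)
    (d : nat -> measure_display) (T : forall n, measurableType (d n))
    (P : forall n, probability (T n) R)
    (X Y : forall n, 'I_n -> {RV (P n) >-> R}) (l : nat -> nat) :
  0 < alpha < 1 ->
  is_density F f ->
  0 < f (quantile_fun F alpha) ->
  {for quantile_fun F alpha, continuous f} ->
  (forall n, mutually_independent (X n)) ->
  (forall n i r, cdf (X n i) r = (F r)%:E) ->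
  (forall n, contaminated (l n) (X n) (Y n)) ->
  ((fun n => (l n)%:R : R^o) =o_\oo (fun n => Num.sqrt n%:R : R^o)) ->
  cvg_in_distribution
    (fun n => Num.sqrt n%:R \o*
       (sample_quantile_rv (Y n) alpha \- cst (quantile_fun F alpha))
     : {RV (P n) >-> R})
    (normal_prob 0 (Num.sqrt (alpha * (1 - alpha) /
                              f (quantile_fun F alpha) ^+ 2))).
Proof.
move=> a01 Ff fq0 cf indep cdfX cont lo x _.
set q := quantile_fun F alpha in fq0 cf *.
have [a0 a1] := andP a01.
have EF r : (F r)%:E = cdf (X 1%N ord0) r by rewrite cdfX.
have F_le : {homo F : x y / x <= y}.
  by move=> y z yz; rewrite -lee_fin !EF cdf_nondecreasing.
have F01 y : 0 <= F y <= 1 by rewrite -!lee_fin EF cdf_ge0 cdf_le1.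
have dF := is_derive_density F f q Ff cf.
have cF : {for q, continuous F}.
  by apply/differentiable_continuous/derivable1_diffP; exact: ex_derive.
have FE : F = fine \o cdf (X 1%N ord0) by apply/funext => r /=; rewrite -EF.
have F_lty : exists y, alpha <= F y.
  have F1 : F y @[y --> +oo] --> (1 : R).
    by rewrite FE; apply: fine_cvg; exact: cvg_cdfy1.
  have H : \forall y \near +oo, alpha <= F y by exact: cvgr_ge F1 _ a1.
  by have [y ay] := filter_ex H; exists y.
have F_gtNy : exists y, F y < alpha.
  have F0 : F y @[y --> -oo] --> (0 : R).
    by rewrite FE; apply: fine_cvg; exact: cvg_cdfNy0.
  have H : \forall y \near -oo, F y < alpha by exact: cvgr_lt F0 _ a0.
  by have [y ay] := filter_ex H; exists y.
have Fq : F q = alpha by exact: (quantile_funK F alpha F_le F_lty F_gtNy cF).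
pose kappa := (f q)^-1.
have kappa0 : 0 < kappa by rewrite invr_gt0.
have -> : Num.sqrt (alpha * (1 - alpha) / f q ^+ 2) =
    kappa * Num.sqrt (alpha * (1 - alpha)).
  rewrite sqrtrM; last by rewrite ltW// mulr_gt0// subr_gt0.
  by rewrite sqrtrV ?sqr_ge0// sqrtr_sqr gtr0_norm// mulrC.
rewrite [X in _ --> X](normal_probE _ x).
pose p n := F (q + x / Num.sqrt n%:R).
have pa : p n @[n --> \oo] --> alpha.
  rewrite -Fq; apply: continuous_cvg; first exact: cF.
  rewrite -[X in _ --> X]addr0; apply: cvgD; first exact: cvg_cst.
  rewrite -[X in _ --> X](mulr0 x); apply: cvgM; first exact: cvg_cst.
  exact: cvg_inv_sqrtn.
(* A threshold n alpha + o(sqrt n) is n (p n) - sqrt n (f q) x + o(sqrt n), by the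
   differentiability of F at q. *)
have tail (e : nat -> R) :
    e n / Num.sqrt n%:R @[n --> \oo] --> (0 : R) ->
    (binomial_mean n (p n)
       (fun k => if n%:R * alpha + e n <= k%:R then 1 else 0))%:E
    @[n --> \oo] --> (normal_cdf (kappa * Num.sqrt (alpha * (1 - alpha))) x)%:E.
  move=> e0; apply/cvg_EFin; first exact: nearW.
  apply: (binomial_clt kappa alpha x p _ kappa0 a01) => //.
    by move=> n; exact: F01.
  have dinc := cvg_scaled_increment F q (f q) x dF.
  suff H : kappa * (e n / Num.sqrt n%:R
      - Num.sqrt n%:R * (F (q + x / Num.sqrt n%:R) - F q))
    @[n --> \oo] --> kappa * (0 - x * f q).
    rewrite (_ : kappa * (0 - x * f q) = - x) in H; last first.
      by rewrite /kappa; field; rewrite lt0r_neq0.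
    apply: cvg_trans H; apply: near_eq_cvg.
    apply: filterS (nbhs_infty_gt 0) => n n0; rewrite /p Fq.
    have sn0 : 0 < Num.sqrt n%:R :> R by rewrite sqrtr_gt0 ltr0n.
    have sn2 : n%:R = Num.sqrt n%:R ^+ 2 :> R by rewrite sqr_sqrtr.
    move: (F _) => Fx; move: (Num.sqrt n%:R) sn0 sn2 => s s0 ->.
    by field; rewrite lt0r_neq0.
  apply: cvgM; first exact: cvg_cst.
  exact: cvgB.
have l0 := littleo_sqrt_cvg l lo.
pose N n w : R := #|sublevel (fun i => X n i w) (q + x / Num.sqrt n%:R)|%:R.
(* The event of the statement lies between these two, which only involve the
   uncontaminated sample. *)
pose lower n := [set w | n%:R * alpha + ((l n)%:R + 1) <= N n w].
pose upper n := [set w | n%:R * alpha + - (l n)%:R <= N n w].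
have prob_tail n (e : R) := prob_card_below (P n) (X n)
  (q + x / Num.sqrt n%:R) (p n) (indep n) (fun i => cdfX n i _)
  (fun k => n%:R * alpha + e <= k%:R).
have tailP (e : nat -> R) :
    e n / Num.sqrt n%:R @[n --> \oo] --> (0 : R) ->
    P n [set w | n%:R * alpha + e n <= N n w] @[n --> \oo] -->
    (normal_cdf (kappa * Num.sqrt (alpha * (1 - alpha))) x)%:E.
  move=> /tail; apply: cvg_trans; apply: near_eq_cvg; apply: nearW => n.
  exact: esym (prob_tail n (e n)).2.
apply: (@squeeze_cvge _ _ _ _ (fun n => P n (lower n)) _ (fun n => P n (upper n))).
- apply: filterS (nbhs_infty_gt 0) => n n0.
  have sn0 : 0 < Num.sqrt n%:R :> R by rewrite sqrtr_gt0 ltr0n.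
  have [S HS] := cont n.
  rewrite /cdf /distribution /pushforward.
  set Z := _ @^-1` _.
  have ZE w : Z w <->
      sample_quantile alpha (fun i => Y n i w) <= q + x / Num.sqrt n%:R.
    by rewrite /Z/= in_itv/= -ler_pdivlMr// lerBlDl.
  have mZ : measurable Z.
    by rewrite -[X in measurable X]setTI; exact: measurable_funP.
  have mL := (prob_tail n ((l n)%:R + 1)).1.
  have mU := (prob_tail n (- (l n)%:R)).1.
  apply/andP; split; apply: le_measure; rewrite ?inE//.
  + move=> w lw; apply/ZE; have [Sl YX] := HS w.
    have [+ _] := sample_quantile_changed (fun i => X n i w)
      (fun i => Y n i w) (S w) alpha (q + x / Num.sqrt n%:R) a01 n0 YX.
    by rewrite Sl; apply.
  + move=> w /ZE Zw; have [Sl YX] := HS w.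
    have [_] := sample_quantile_changed (fun i => X n i w)
      (fun i => Y n i w) (S w) alpha (q + x / Num.sqrt n%:R) a01 n0 YX.
    by rewrite Sl; apply.
- apply: (tailP (fun n => (l n)%:R + 1)).
  have /(_ _) := cvgD l0 cvg_inv_sqrtn; rewrite addr0; apply: cvg_trans.
  by apply/near_eq_cvg/nearW => n /=; rewrite mulrDl mul1r.
- apply: (tailP (fun n => - (l n)%:R)).
  have /(_ _) := cvgN l0; rewrite oppr0; apply: cvg_trans.
  by apply/near_eq_cvg/nearW => n /=; rewrite mulNr.
Qed.
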